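(* Let $A$ and $B$ be independent nonnegative random variables, let $X=B-A$ with $\mathbb{P}[X<0]>0$, and let $W$ be the steady-state limit of the recursion $W_{n+1}=\max\{0,X_{n+1}-W_n\}$. Suppose that $e^B$ is rapidly varying with index $-\infty$. Then, as $x\to\infty$, $$\mathbb{P}[W>x]\sim\mathbb{P}[X>x]\;\mathbb{P}[W=0].$$
   Context: Let $\{A_n\}$ and $\{B_n\}$ be two mutually independent sequences of i.i.d. nonnegative random variables distributed as $A$ and $B$ respectively, $X_{n+1}=B_{n+1}-A_n$ for $n\geqslant 1$, and $W_{n+1}=\max\{0,X_{n+1}-W_n\}$, with $W_1\geqslant 0$ independent of $\{X_n\}_{n\geqslant 2}$. Since $\mathbb{P}[X<0]>0$, the law of $W_n$ converges, irrespective of the initial state, to a unique limiting distribution; $W$ is a random variable with this distribution, and, with $W$ independent of $X$, it satisfies $W\stackrel{\mathcal{D}}{=}\max\{0,X-W\}$ (equality in distribution). ''$e^B$ is rapidly varying with index $-\infty$'' means that $\mathbb{P}[B>x]>0$ for all $x$ and $\lim_{x\to\infty}\mathbb{P}[B>x+y]/\mathbb{P}[B>x]$ equals $0$ if $y>0$, $1$ if $y=0$, and $\infty$ if $y<0$. The notation $f(x)\sim g(x)$ means $f(x)/g(x)\to 1$ as $x\to\infty$. *)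

(* Defs.v *)
From HB Require Import structures.
From mathcomp Require Export all_boot all_order all_algebra finmap.
From mathcomp Require Export all_classical all_reals all_analysis.
Export Order.TTheory GRing.Theory Num.Theory.
Export numFieldNormedType.Exports.

Set Implicit Arguments.
Unset Strict Implicit.
Unset Printing Implicit Defensive.

Local Open Scope classical_set_scope.
Local Open Scope ring_scope.

Section RandomVariables.
Context {d : measure_display} {T : measurableType d} {R : realType}.
Variable P : probability T R.

(* The equality is required on Borel sets only: [distribution P X] is a
   function on all of [set R], whose values elsewhere are meaningless. *)
Definition same_law (X Y : {RV P >-> R}) : Prop :=
  forall E : set R, measurable E -> distribution P X E = distribution P Y E.

Definition independent_RV (X Y : {RV P >-> R}) : Prop :=
  forall E F : set R, measurable E -> measurable F ->
    P (X @^-1` E `&` Y @^-1` F) = (P (X @^-1` E) * P (Y @^-1` F))%E.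

Definition mutually_independent (I : choiceType) (X_ : I -> {RV P >-> R})
    : Prop :=
  forall (J : {fset I}) (E : I -> set R), (forall i, measurable (E i)) ->
    P (\bigcap_(i in [set` J]) X_ i @^-1` E i) =
    (\prod_(i <- J) P (X_ i @^-1` E i))%E.

(* Independence of two families from each other (that is, of the sigma-algebras
   they generate), stated on finite-dimensional cylinders; nothing is required
   of the members within one family. *)
Definition independent_families (I K : choiceType)
    (X_ : I -> {RV P >-> R}) (Y_ : K -> {RV P >-> R}) : Prop :=
  forall (J : {fset I}) (L : {fset K}) (E : I -> set R) (F : K -> set R),
    (forall i, measurable (E i)) -> (forall k, measurable (F k)) ->
    P ((\bigcap_(i in [set` J]) X_ i @^-1` E i) `&`
       (\bigcap_(k in [set` L]) Y_ k @^-1` F k)) =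
    (P (\bigcap_(i in [set` J]) X_ i @^-1` E i) *
     P (\bigcap_(k in [set` L]) Y_ k @^-1` F k))%E.

(* Weak convergence of the laws, tested on bounded continuous functions. *)
Definition cvg_in_law (X_ : nat -> {RV P >-> R}) (X : {RV P >-> R}) : Prop :=
  forall f : R -> R, continuous f -> (exists M : R, forall x, `|f x| <= M) ->
    ('E_P[f \o X_ n] @[n --> \oo] --> 'E_P[f \o X])%E.

(* P[X > x] as a real number. *)
Definition tail (X : {RV P >-> R}) (x : R) : R := fine (ccdf X x).

(* "e^X is rapidly varying with index -oo", expressed through X itself:
   P[e^X > l * u] / P[e^X > u] with u = e^x and l = e^y. *)
Definition exp_rapidly_varyingNy (X : {RV P >-> R}) : Prop :=
  (forall x, 0 < tail X x) /\
  (forall y : R,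
    [/\ 0 < y -> tail X (x + y) / tail X x @[x --> +oo] --> (0 : R),
        y = 0 -> tail X (x + y) / tail X x @[x --> +oo] --> (1 : R) &
        y < 0 -> tail X (x + y) / tail X x @[x --> +oo] --> +oo]).

(* Sequences are indexed from 0, so index n stands for the usual n + 1;
   the value X_ 0 is never used. *)
Definition lindley_recursion (X_ W_ : nat -> {RV P >-> R}) : Prop :=
  forall n t, W_ n.+1 t = Num.max 0 (X_ n.+1 t - W_ n t).

End RandomVariables.

(* Main.v *)
From HB Require Import structures.
From mathcomp Require Import measurable_realfun ring.
Require Import Defs.

Local Open Scope classical_set_scope.
Local Open Scope ring_scope.

(** The law of W is a fixed point of the recursion: for x >= 0,
        P[W > x] = E[ P[X > x + W] ],
    the inner probability being taken over an X independent of W. As W >= 0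
    almost surely, the event W = 0 contributes exactly P[X > x] P[W = 0], which
    is a lower bound. On the remaining event, either W <= y, which contributes
    at most P[X > x] P[0 < W <= y], or W > y, which contributes at most
    P[X > x + y]. Hence
        P[X > x] P[W = 0] <= P[W > x] <= P[X > x] P[W <= y] + P[X > x + y]
    ([tail_fix_ge] and [tail_fix_le]). The right-continuity of the distribution
    function of W at 0 makes P[W <= y] close to P[W = 0] for small y > 0, and
    rapid variation of X makes P[X > x + y] negligible before P[X > x] once y is
    fixed; this is [tail_fix_equiv].

    Rapid variation passes from B to X = B - A ([tail_diff_rapid]) because
    P[X > x] = E[ P[B > x + A] ] and A >= 0: a bound
    P[B > u + y] <= e P[B > u] valid for all large u holds at u = x + A for all
    values of A at once, and survives integration. Positivity of P[W = 0]
    follows from P[W > 0] <= P[X > 0] < 1.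

    The fixed-point equation has to be extracted from convergence in law, under
    which the probabilities P[W_n > x] and P[W_n = 0] need not converge to those
    of W. For a bounded continuous f, however,
        E[f(W_(n+1))] = E[g(W_n)]  with  g(w) = E[f(max(0, X - w))],
    and g is again bounded and continuous, so that both sides pass to the limit
    ([lindley_stationary_integral]). Letting f increase to the indicator of
    (x, +oo) through piecewise affine functions gives the equation for tails
    ([ccdf_stationary]).

    The formula for E[f(W_(n+1))] needs W_n to be independent of X_(n+1), and
    X_(n+1) to be distributed as X. Both come down to the fact that a measure on
    the plane is determined by its values on rectangles: it gives the
    independence of the X_n from that of the A_n and B_n
    ([mutually_independent_pairs]), then that of W_n and X_(n+1) by induction
    along the recursion ([recursion_independent]). *)

(** * Independence and laws of pairs *)

Section Independence.
Context {R : realType} {d : measure_display} {T : measurableType d}.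
Variable P : probability T R.
Implicit Types U V : {RV P >-> R}.
Local Open Scope ereal_scope.
Set Implicit Arguments.
Unset Strict Implicit.
Unset Printing Implicit Defensive.

Definition RV_pair U V (t : T) : R * R := (U t, V t).

Lemma measurable_RV_pair U V : measurable_fun [set: T] (RV_pair U V).
Proof. exact: measurable_fun_pair. Qed.

HB.instance Definition _ U V :=
  isMeasurableFun.Build _ _ _ _ (RV_pair U V) (measurable_RV_pair U V).

Lemma measurable_RV_preimage U (E : set R) :
  measurable E -> measurable (U @^-1` E).
Proof.
by move=> mE; rewrite -[X in measurable X]setTI; exact: measurable_funP.
Qed.

(** Both sides are finite measures in [Q], so that agreement on rectangles is
    enough. This is the step that turns independence of [U] and [V] from an
    event into independence of any measurable function of [(U, V)] from it. *)
Lemma pair_event_indep U V (D : set T) (mD : measurable D) :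
  (forall E F : set R, measurable E -> measurable F ->
    P (U @^-1` E `&` V @^-1` F `&` D) = P (U @^-1` E `&` V @^-1` F) * P D) ->
  forall Q : set (R * R), measurable Q ->
    P (RV_pair U V @^-1` Q `&` D) = P (RV_pair U V @^-1` Q) * P D.
Proof.
move=> rectD Q mQ.
have PD_ge0 : (0 <= fine (P D))%R by exact: fine_ge0.
pose m1 : {measure set (R * R) -> \bar R} :=
  pushforward (mrestr P mD) (RV_pair U V).
pose m2 : {measure set (R * R) -> \bar R} :=
  mscale (NngNum PD_ge0) (distribution P (RV_pair U V)).
have m2E A : m2 A = P (RV_pair U V @^-1` A) * P D.
  by rewrite /m2 /= /mscale /= fineK ?fin_num_measure// muleC.
rewrite -m2E; apply: (measure_unique
    [set A `*` B | A in measurable & B in measurable] (fun=> setT) _ _ _ _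
    (m1 (measurable_RV_pair U V)) m2).
- exact: measurable_prod_measurableType.
- move=> _ _ [E1 mE1 [F1 mF1 <-]] [E2 mE2 [F2 mF2 <-]].
  rewrite -setXI; exists (E1 `&` E2); first exact: measurableI.
  by exists (F1 `&` F2) => //; exact: measurableI.
- by move=> _; exists setT => //; exists setT => //; rewrite setXTT.
- by rewrite bigcup_const.
- by move=> _ [E mE [F mF <-]]; rewrite m2E; exact: rectD.
- move=> _; rewrite /m1 /= /pushforward /mrestr.
  by rewrite preimage_setT setTI -ge0_fin_numE ?fin_num_measure.
- exact: mQ.
Qed.

Definition cylinder {I : choiceType} (Z : I -> {RV P >-> R}) (J : {fset I})
  (E : I -> set R) : set T := \bigcap_(i in [set` J]) Z i @^-1` E i.

Lemma measurable_cylinder {I : choiceType} (Z : I -> {RV P >-> R}) J E :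
  (forall i, measurable (E i)) -> measurable (cylinder Z J E).
Proof.
move=> mE; apply: fin_bigcap_measurable => [|i _]; first exact: finite_fset.
exact: measurable_RV_preimage.
Qed.

Lemma cylinderU1 {I : choiceType} (Z : I -> {RV P >-> R}) k J E :
  cylinder Z (k |` J)%fset E = Z k @^-1` E k `&` cylinder Z J E.
Proof. by rewrite /cylinder set_fsetU1 bigcap_setU1. Qed.

Lemma cylinder0 {I : choiceType} (Z : I -> {RV P >-> R}) E :
  cylinder Z fset0 E = setT.
Proof. by rewrite /cylinder set_fset0 bigcap_set0. Qed.

Lemma cylinder1 {I : choiceType} (Z : I -> {RV P >-> R}) k E :
  cylinder Z [fset k]%fset E = Z k @^-1` E k.
Proof. by rewrite /cylinder set_fset1 bigcap_set1. Qed.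

Lemma eq_cylinder {I : choiceType} (Z : I -> {RV P >-> R}) (J : {fset I}) E F :
  {in J, E =1 F} -> cylinder Z J E = cylinder Z J F.
Proof. by move=> EF; apply: eq_bigcapr => i iJ; rewrite EF. Qed.

Definition update {I : choiceType} (E : I -> set R) (k : I) (F : set R) i :=
  if i == k then F else E i.

Lemma measurable_update {I : choiceType} (E : I -> set R) k F :
  (forall i, measurable (E i)) -> measurable F ->
  forall i, measurable (update E k F i).
Proof. by move=> mE mF i; rewrite /update; case: ifP. Qed.

Lemma eq_update {I : choiceType} (E : I -> set R) k F (J : {fset I}) :
  k \notin J -> {in J, update E k F =1 E}.
Proof.
by move=> kJ i iJ; rewrite /update; case: eqP => // ik; rewrite -ik iJ in kJ.
Qed.

(** Merging a constraint on a fresh index into a cylinder lets the hypotheses of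
    independence, which speak of cylinders only, be applied to events of the
    form on the left. *)
Lemma cylinder_update {I : choiceType} (Z : I -> {RV P >-> R}) k J E F :
  k \notin J ->
  Z k @^-1` F `&` cylinder Z J E = cylinder Z (k |` J)%fset (update E k F).
Proof.
move=> kJ; rewrite cylinderU1 {1}/update eqxx.
by rewrite (eq_cylinder Z (eq_update E F kJ)).
Qed.

Lemma mutually_independent_event {I : choiceType} (Z : I -> {RV P >-> R}) k J
    (E : I -> set R) (F : set R) :
  mutually_independent Z -> k \notin J -> (forall i, measurable (E i)) ->
  measurable F ->
  P (Z k @^-1` F `&` cylinder Z J E) = P (Z k @^-1` F) * P (cylinder Z J E).
Proof.
move=> indZ kJ mE mF; have mG := measurable_update k mE mF.
rewrite cylinder_update// [LHS]indZ// big_fsetU1//= {1}/update eqxx.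
by rewrite -(eq_cylinder Z (eq_update E F kJ)) [in RHS]indZ.
Qed.

(** Reindexing along an injection: the sets prescribed for [Z \o f] are carried
    to the indices of [Z] by the left inverse [g]. *)
Lemma cylinder_comp {I K : choiceType} (f : K -> I) (g : I -> K)
    (Z : I -> {RV P >-> R}) J E :
  cancel f g ->
  cylinder Z [fset f k | k in J]%fset (E \o g) = cylinder (Z \o f) J E.
Proof.
move=> fK; rewrite /cylinder set_imfset bigcap_image.
by apply: eq_bigcapr => k _ /=; rewrite fK.
Qed.

Lemma mutually_independent_comp {I K : choiceType} (f : K -> I) (g : I -> K)
    (Z : I -> {RV P >-> R}) :
  cancel f g -> mutually_independent Z -> mutually_independent (Z \o f).
Proof.
move=> fK indZ J E mE.
have := indZ [fset f k | k in J]%fset (E \o g) (fun i => mE (g i)).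
rewrite -/(cylinder _ _ _) cylinder_comp// big_imfset/=; last first.
  by move=> i j _ _; exact: (can_inj fK).
by under eq_bigr do rewrite fK.
Qed.

Lemma independent_families_comp {I K L : choiceType} (f : K -> I) (g : I -> K)
    (Y : L -> {RV P >-> R}) (Z : I -> {RV P >-> R}) :
  cancel f g -> independent_families Y Z -> independent_families Y (Z \o f).
Proof.
move=> fK indYZ J L' E F mE mF.
have := indYZ J [fset f k | k in L']%fset E (F \o g) mE (fun i => mF (g i)).
by rewrite -!/(cylinder _ _ _) cylinder_comp.
Qed.

Lemma independent_families_RV {I K : choiceType}
    (Y : I -> {RV P >-> R}) (Z : K -> {RV P >-> R}) i k :
  independent_families Y Z -> independent_RV (Y i) (Z k).
Proof.
move=> indYZ E F mE mF.
have := indYZ [fset i]%fset [fset k]%fset (fun=> E) (fun=> F).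
by rewrite !set_fset1 !bigcap_set1; exact.
Qed.

(** The pairs [(U i, V i)] are replaced by the [Z i] one at a time: the induction
    on [J] keeps a cylinder of [U] and [V] over indices outside [J], from which
    the next pair is drawn and to which it is independent of everything else. *)
Lemma mutually_independent_pairs {I : choiceType} (U V Z : I -> {RV P >-> R})
    (h : R * R -> R) :
  measurable_fun setT h -> (forall i t, Z i t = h (U i t, V i t)) ->
  mutually_independent U -> mutually_independent V ->
  independent_families U V -> mutually_independent Z.
Proof.
move=> mh ZE indU indV indUV J E mE.
suff main (J' : {fset I}) F G : [disjoint J & J']%fset ->
    (forall i, measurable (F i)) -> (forall i, measurable (G i)) ->
    P (cylinder Z J E `&` (cylinder U J' F `&` cylinder V J' G)) =
    (\prod_(i <- J) P (Z i @^-1` E i)) *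
    P (cylinder U J' F `&` cylinder V J' G).
  have := main fset0 (fun=> setT) (fun=> setT).
  rewrite !cylinder0 !setIT probability_setT mule1; apply => //.
  exact: fdisjointX0.
elim/fset1U_rect: J J' F G => [|k J kJ IH] J' F G.
  by move=> _ mF mG; rewrite cylinder0 setTI big_seq_fset0 mul1e.
move=> JJ' mF mG.
have /andP[kJ' {}JJ'] : (k \notin J') && [disjoint J & J']%fset.
  by rewrite -fdisjointU1X.
rewrite cylinderU1 big_fsetU1//= -setIA.
have UVk E' F' : measurable E' -> measurable F' ->
    P (U k @^-1` E' `&` V k @^-1` F') = P (U k @^-1` E') * P (V k @^-1` F').
  exact: independent_families_RV.
have UVJ : P (cylinder U J' F `&` cylinder V J' G) =
    P (cylinder U J' F) * P (cylinder V J' G) by exact: indUV.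
set D := cylinder Z J E `&` _.
have mD : measurable D.
  by repeat apply: measurableI; exact: measurable_cylinder.
have -> : Z k @^-1` E k = RV_pair (U k) (V k) @^-1` (h @^-1` E k).
  by apply/seteqP; split => t; rewrite /preimage/= ZE.
rewrite pair_event_indep//; last 2 first.
- move=> E' F' mE' mF'.
  have mF1 := measurable_update k mF mE'.
  have mG1 := measurable_update k mG mF'.
  have -> : U k @^-1` E' `&` V k @^-1` F' `&` D =
      cylinder Z J E `&` (cylinder U (k |` J')%fset (update F k E') `&`
                          cylinder V (k |` J')%fset (update G k F')).
    rewrite /D -!cylinder_update// !setIA.
    by apply/seteqP; split => t /=; tauto.
  rewrite IH//; last by rewrite fdisjointXU fdisjointX1 kJ.
  rewrite [P (cylinder U _ _ `&` _)]indUV// -!/(cylinder _ _ _).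
  rewrite -!cylinder_update// !mutually_independent_event//.
  by rewrite UVk// IH// UVJ muleACA [LHS]muleCA.
- by rewrite -[X in measurable X]setTI; exact: mh.
by rewrite IH// muleA.
Qed.

(** The induction carries more than the conclusion: [Y n] is independent of all
    the [Z j] with [n <= j] jointly. The next value [Y n.+1] is a function of
    [Y n] and [Z n], and this pair is independent of the [Z j] with [n < j]. *)
Lemma recursion_independent (Y Z : nat -> {RV P >-> R}) (h : R * R -> R) :
  measurable_fun setT h -> (forall n t, Y n.+1 t = h (Y n t, Z n t)) ->
  mutually_independent Z ->
  independent_families (fun _ : unit => Y 0%N) Z ->
  forall n, independent_RV (Y n) (Z n).
Proof.
move=> mh YE indZ indYZ.
suff main n (J : {fset nat}) E F : {in J, forall j, (n <= j)%N} ->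
    measurable E -> (forall i, measurable (F i)) ->
    P (Y n @^-1` E `&` cylinder Z J F) = P (Y n @^-1` E) * P (cylinder Z J F).
  move=> n E F mE mF; have := main n [fset n]%fset E (fun=> F).
  by rewrite cylinder1; apply => // j; rewrite inE => /eqP ->.
elim: n J E F => [J E F _ mE mF|n IH J E F Jn mE mF].
  have := indYZ [fset tt]%fset J (fun=> E) F.
  by rewrite set_fset1 bigcap_set1; exact.
have nJ : n \notin J by apply/negP => /Jn; rewrite ltnn.
have -> : Y n.+1 @^-1` E = RV_pair (Y n) (Z n) @^-1` (h @^-1` E).
  by apply/seteqP; split => t; rewrite /preimage/= YE.
apply: pair_event_indep; first exact: measurable_cylinder.
- move=> E' F' mE' mF'.
  have mF1 := measurable_update n mF mF'.
  have geJ : {in (n |` J)%fset, forall j, (n <= j)%N}.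
    by move=> j /fset1UP[->//|/Jn/ltnW].
  have gen : {in [fset n]%fset, forall j, (n <= j)%N}.
    by move=> j; rewrite inE => /eqP ->.
  rewrite -setIA cylinder_update// IH// -cylinder_update//.
  rewrite mutually_independent_event// muleA; congr (_ * _).
  by rewrite -[Z n @^-1` F'](cylinder1 Z n (fun=> F')) IH.
- by rewrite -[X in measurable X]setTI; exact: mh.
Qed.

Lemma indep_pair_law (U V U' V' : {RV P >-> R}) (Q : set (R * R)) :
  independent_RV U V -> same_law U U' -> same_law V V' ->
  measurable Q ->
  P (RV_pair U V @^-1` Q) = (distribution P U' \x distribution P V') Q.
Proof.
move=> indUV lawU lawV mQ; apply/esym.
rewrite -[RHS]/(distribution P (RV_pair U V) Q).
apply: product_measure_unique => // E F mE mF.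
transitivity (distribution P U E * distribution P V F); first exact: indUV.
by congr (_ * _); [exact: lawU|exact: lawV].
Qed.

(** Tonelli for the joint law of an independent pair; the variables of the
    iterated integral matter through their laws only, hence [U'] and [V']. *)
Lemma indep_pair_integral (U V U' V' : {RV P >-> R}) (f : R * R -> \bar R) :
  independent_RV U V -> same_law U U' -> same_law V V' ->
  measurable_fun setT f -> (forall z, 0 <= f z) ->
  \int[P]_t f (U t, V t) = \int[P]_s \int[P]_t f (U' s, V' t).
Proof.
move=> indUV lawU lawV mf f_ge0.
rewrite -[LHS](ge0_integral_distribution (RV_pair U V))//.
rewrite (eq_measure_integral
    (distribution P U' \x distribution P V')) => [|Q mQ _].
  rewrite fubini_tonelli1//.
  rewrite ge0_integral_distribution//=; first last.
  - by move=> u; exact: integral_ge0.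
  - exact: measurable_fun_fubini_tonelli_F.
  apply: eq_integral => s _; rewrite /fubini_F.
  by rewrite ge0_integral_distribution//; exact: measurableT_comp.
exact: indep_pair_law.
Qed.

Lemma same_law_of_pair (U V U' V' Z Z' : {RV P >-> R}) (h : R * R -> R) :
  measurable_fun setT h ->
  (forall t, Z t = h (U t, V t)) -> (forall t, Z' t = h (U' t, V' t)) ->
  independent_RV U V -> independent_RV U' V' ->
  same_law U U' -> same_law V V' -> same_law Z Z'.
Proof.
move=> mh ZE Z'E indUV indUV' lawU lawV E mE.
have mhE : measurable (h @^-1` E).
  by rewrite -[X in measurable X]setTI; exact: mh.
have pre (A B C : {RV P >-> R}) : (forall t, C t = h (A t, B t)) ->
    distribution P C E = P (RV_pair A B @^-1` (h @^-1` E)).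
  move=> CE; congr (P _).
  by apply/seteqP; split => t; rewrite /preimage/= CE.
rewrite (pre U V)// (pre U' V')//.
rewrite (indep_pair_law indUV lawU lawV)//.
by rewrite (@indep_pair_law U' V' U' V').
Qed.

End Independence.

(** * Passing to the limit in the recursion *)

Section Stationarity.
Context {R : realType} {d : measure_display} {T : measurableType d}.
Variable P : probability T R.
Local Open Scope ereal_scope.
Set Implicit Arguments.
Unset Strict Implicit.
Unset Printing Implicit Defensive.

Definition lindley_map (z : R * R) : R := Num.max 0%R (z.2 - z.1)%R.

Lemma measurable_lindley_map : measurable_fun setT lindley_map.
Proof.
apply: measurable_maxr => //; apply: measurable_funB; last exact: measurable_fst.
exact: measurable_snd.
Qed.

Lemma continuous_lindley_map_fst (x : R) :
  continuous (fun w : R => lindley_map (w, x)).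
Proof.
apply: max_fun_continuous; first by move=> w; exact: cvg_cst.
by move=> w; apply: cvgB; [exact: cvg_cst|exact: cvg_id].
Qed.

Lemma measurable_lindley_step (X : {RV P >-> R}) (w : R) :
  measurable_fun setT (fun t => lindley_map (w, X t)).
Proof.
apply: measurableT_comp; first exact: measurable_lindley_map.
by apply: measurable_fun_pair.
Qed.

Section BoundedTest.
Variables (f : R -> R) (M : R).
Hypotheses (cf : continuous f) (f_ge0 : forall u, (0 <= f u)%R)
  (fM : forall u, (f u <= M)%R).

Let mf : measurable_fun setT f.
Proof. exact: continuous_measurable_fun. Qed.

Let norm_fM u : (`|f u| <= M)%R.
Proof. by rewrite ger0_norm. Qed.

Let integrable_f (Y : T -> R) : measurable_fun setT Y ->
  P.-integrable setT (EFin \o (f \o Y)).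
Proof.
move=> mY; apply: measurable_bounded_integrable => //.
- by rewrite -ge0_fin_numE ?fin_num_measure.
- exact: measurableT_comp.
- exists M; split; first exact: num_real.
  by move=> N MN t _ /=; exact: le_trans (norm_fM _) (ltW MN).
Qed.

(** The transition operator of the chain [W_], applied to the test function [f]
    and read off at the state [w]. *)
Definition lindley_operator (X : {RV P >-> R}) (w : R) : R :=
  fine (\int[P]_t (f (lindley_map (w, X t)))%:E).

Lemma lindley_operatorE (X : {RV P >-> R}) (w : R) :
  \int[P]_t (f (lindley_map (w, X t)))%:E = (lindley_operator X w)%:E.
Proof.
rewrite fineK//; apply: integrable_fin_num => //.
exact/(integrable_f (measurable_lindley_step X w)).
Qed.

Lemma lindley_operator_bound (X : {RV P >-> R}) (w : R) :
  (`|lindley_operator X w| <= M)%R.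
Proof.
rewrite ger0_norm; last first.
  by rewrite fine_ge0// integral_ge0// => t _; rewrite lee_fin.
rewrite -lee_fin -lindley_operatorE.
rewrite [leRHS](_ : _ = \int[P]_t (cst M%:E t)).
  apply: ge0_le_integral => //.
  - by move=> t _; rewrite lee_fin.
  - apply/measurable_EFinP/(measurableT_comp mf).
    exact: measurable_lindley_step.
  - by move=> t _; rewrite lee_fin.
by rewrite integral_cst//= [P _]probability_setT mule1.
Qed.

(** The Feller property of the chain: convergence in law may then be tested
    against the image of [f] as well as against [f] itself. *)
Lemma continuous_lindley_operator (X : {RV P >-> R}) :
  continuous (lindley_operator X).
Proof.
move=> w.
(* Any open interval around w will do, the domination being uniform. *)
have wI : w \in (`](w - 1)%R, (w + 1)%R[%classic : set R).
  by rewrite inE/= in_itv/= ltrBlDr !ltrDl !ltr01.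
apply: (@continuity_under_integral _ _ T P
  (fun w t => f (lindley_map (w, X t))) setT measurableT (w - 1)%R (w + 1)%R
  _ _ (cst M)) => //.
- by move=> x _; exact/(integrable_f (measurable_lindley_step X x)).
- apply: aeW => t _ x _; apply: continuous_comp; last exact: cf.
  exact: continuous_lindley_map_fst.
- exact: finite_measure_integrable_cst.
- by move=> x _; apply: aeW => t _ /=.
Qed.

(** The expectations of [f \o W_ n.+1] and of [lindley_operator X \o W_ n] are
    equal, since [W_ n] is independent of [X_ n.+1], and their limits are the two
    sides. *)
Lemma lindley_stationary_integral (X W : {RV P >-> R})
    (X_ W_ : nat -> {RV P >-> R}) :
  (forall n, same_law (X_ n.+1) X) ->
  (forall n, independent_RV (W_ n) (X_ n.+1)) ->
  lindley_recursion X_ W_ -> cvg_in_law W_ W ->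
  \int[P]_t (f (W t))%:E =
  \int[P]_s \int[P]_t (f (lindley_map (W s, X t)))%:E.
Proof.
move=> lawX indWX W_rec W_lim.
have bdf : exists M : R, forall x, (`|f x| <= M)%R by exists M.
have bdg : exists M : R, forall x, (`|lindley_operator X x| <= M)%R.
  by exists M => x; exact: lindley_operator_bound.
have fW := W_lim f cf bdf.
have gW := W_lim _ (@continuous_lindley_operator X) bdg.
have fWS : 'E_P[f \o W_ n.+1] @[n --> \oo] --> 'E_P[f \o W].
  by rewrite (cvg_shiftS (fun n => 'E_P[f \o W_ n])).
have fgE n : 'E_P[f \o W_ n.+1] = 'E_P[lindley_operator X \o W_ n].
  rewrite unlock /comp.
  under eq_integral do
    rewrite W_rec -[Num.max _ _]/(lindley_map (W_ n _, X_ n.+1 _)).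
  rewrite (indep_pair_integral (U' := W_ n) (V' := X)
    (f := EFin \o f \o lindley_map)) => //=.
  - by apply: eq_integral => s _; rewrite -lindley_operatorE.
  - apply/measurable_EFinP/measurableT_comp => //; exact: measurable_lindley_map.
  - by move=> z; rewrite lee_fin.
move: fWS; rewrite (funext fgE) => fWS.
have := cvg_unique (@ereal_hausdorff R) fWS gW; rewrite unlock => fgW.
rewrite [LHS]fgW.
by apply: eq_integral => s _; rewrite -lindley_operatorE.
Qed.

End BoundedTest.
End Stationarity.

(** * Tails as integrals *)

Section Tails.
Context {R : realType} {d : measure_display} {T : measurableType d}.
Variable P : probability T R.
Local Open Scope ereal_scope.
Set Implicit Arguments.
Unset Strict Implicit.
Unset Printing Implicit Defensive.

Lemma ccdfE (Y : {RV P >-> R}) x : ccdf Y x = P [set t | (x < Y t)%R].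
Proof.
by congr (P _); apply/seteqP; split => t; rewrite /= in_itv/= andbT.
Qed.

(** Conditioning on [V]: the section at [v] of the half-plane [x < u - v] is the
    half-line [x + v < u]. *)
Lemma ccdf_indep_diff (U V Z : {RV P >-> R}) (x : R) :
  independent_RV V U -> (forall t, Z t = U t - V t)%R ->
  ccdf Z x = \int[P]_s ccdf U (x + V s)%R.
Proof.
move=> indVU ZE.
pose Q : set (R * R) := (fun z => z.2 - z.1)%R @^-1` `]x, +oo[.
have mQ : measurable Q.
  rewrite -[X in measurable X]setTI.
  suff mdiff : measurable_fun setT (fun z : R * R => z.2 - z.1)%R.
    by apply: mdiff => //; exact: measurable_itv.
  by apply: measurable_funB; [exact: measurable_snd|exact: measurable_fst].
transitivity (P (RV_pair V U @^-1` Q)).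
  by congr (P _); apply/seteqP; split => t; rewrite /preimage/= ZE.
rewrite (indep_pair_law (U' := V) (V' := U))//.
rewrite -[LHS]/(\int[distribution P V]_v (distribution P U \o xsection Q) v).
rewrite ge0_integral_distribution//; last exact: measurable_fun_xsection.
apply: eq_integral => s _ /=; rewrite ccdfE; congr (P _).
by apply/seteqP; split => t; rewrite /preimage/= /xsection/= in_setE /Q/=
  in_itv/= andbT ltrBrDr.
Qed.

(** Continuous functions increasing with [k] to the indicator of the open
    half-line beyond [x]: affine between [x] and [x + 1 / k] when
    [k] is positive. *)
Definition ramp (x : R) (k : nat) (u : R) : R :=
  Num.min 1%R (Num.max 0%R (k%:R * (u - x))%R).

Lemma ramp_ge0 x k u : (0 <= ramp x k u)%R.
Proof. by rewrite le_min ler01 le_max lexx. Qed.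

Lemma ramp_le1 x k u : (ramp x k u <= 1)%R.
Proof. by rewrite ge_min lexx. Qed.

Lemma continuous_ramp x k : continuous (ramp x k).
Proof.
apply: min_fun_continuous; first by move=> u; exact: cvg_cst.
apply: max_fun_continuous; first by move=> u; exact: cvg_cst.
move=> u; apply: cvgM; first exact: cvg_cst.
by apply: cvgB; [exact: cvg_id|exact: cvg_cst].
Qed.

Lemma measurable_ramp x k : measurable_fun setT (ramp x k).
Proof. by apply: continuous_measurable_fun; exact: continuous_ramp. Qed.

Lemma ramp_eq0 x k u : (u <= x)%R -> ramp x k u = 0%R.
Proof.
move=> ux; rewrite /ramp max_l; first by rewrite min_r.
by rewrite mulr_ge0_le0// subr_le0.
Qed.

Lemma ramp_homo x u :
  {homo (fun k => ramp x k u) : m n / (m <= n)%N >-> (m <= n)%R}.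
Proof.
move=> m n mn; have [ux|xu] := leP u x; first by rewrite !ramp_eq0.
apply: le_min2 => //; apply: le_max2 => //.
by rewrite ler_wpM2r ?ler_nat// subr_ge0 ltW.
Qed.

Lemma cvg_ramp x u :
  (ramp x k u)%:E @[k --> \oo] --> (\1_[set v | (x < v)%R] u)%:E.
Proof.
apply: cvg_EFin; first exact: nearW.
rewrite indicE; case: (leP u x) => ux.
  rewrite memNset/=; last by rewrite ltNge ux.
  rewrite (_ : (fun k => _) = fun=> 0%R); first exact: cvg_cst.
  by apply/funext => k; rewrite ramp_eq0.
rewrite mem_set//=.
apply: cvg_near_cst; near=> k.
rewrite /= /ramp min_l// le_max; apply/orP; right.
rewrite -ler_pdivrMr ?subr_gt0// mul1r.
by near: k; exact: nbhs_infty_ger.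
Unshelve. all: by end_near. Qed.

Lemma cvg_ramp_integral x (Y : T -> R) : measurable_fun setT Y ->
  \int[P]_t (ramp x k (Y t))%:E @[k --> \oo] --> P [set t | (x < Y t)%R].
Proof.
move=> mY.
have mE : measurable [set t | (x < Y t)%R].
  rewrite [X in measurable X](_ : _ = setT `&` Y @^-1` `]x, +oo[).
    by apply: mY => //; exact: measurable_itv.
  by rewrite setTI; apply/seteqP; split => t; rewrite /= in_itv/= andbT.
rewrite [X in _ --> X](_ : _ = \int[P]_t limn (fun k => (ramp x k (Y t))%:E)).
  apply: cvg_monotone_convergence => //.
  - move=> k; apply/measurable_EFinP/measurableT_comp => //.
    exact: measurable_ramp.
  - by move=> k t _; rewrite lee_fin ramp_ge0.
  - by move=> t _ m n mn; rewrite lee_fin ramp_homo.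
rewrite -[in LHS](setIT [set t | (x < Y t)%R]) -integral_indic//.
by apply: eq_integral => t _; apply/esym/cvg_lim => //; exact: cvg_ramp.
Qed.

Section Stationary.
Variables (X W : {RV P >-> R}) (X_ W_ : nat -> {RV P >-> R}).
Hypotheses (lawX : forall n, same_law (X_ n.+1) X)
  (indWX : forall n, independent_RV (W_ n) (X_ n.+1))
  (W_rec : lindley_recursion X_ W_) (W_lim : cvg_in_law W_ W).

(** Monotone convergence along the ramps at [x], once on the left and twice in the
    iterated integral on the right. The hypothesis on [x] makes the truncation at
    0 invisible: [max(0, X - W) > x] is then the same as [X > x + W]. *)
Lemma ccdf_stationary x : (0 <= x)%R ->
  ccdf W x = \int[P]_s ccdf X (x + W s)%R.
Proof.
move=> x_ge0.
have lim1 := cvg_ramp_integral (x := x) (measurable_funPT W).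
have cr k := @continuous_ramp x k.
have r_ge0 k := @ramp_ge0 x k.
have r_le1 k := @ramp_le1 x k.
have E k := lindley_stationary_integral (cr k) (r_ge0 k) (r_le1 k)
  lawX indWX W_rec W_lim.
rewrite (funext E) in lim1.
suff lim2 : \int[P]_s \int[P]_t (ramp x k (lindley_map (W s, X t)))%:E
    @[k --> \oo] --> \int[P]_s ccdf X (x + W s)%R.
  by rewrite ccdfE; exact: (cvg_unique (@ereal_hausdorff R) lim1 lim2).
rewrite [X in _ --> X](_ : _ = \int[P]_s limn (fun k =>
    \int[P]_t (ramp x k (lindley_map (W s, X t)))%:E)).
  apply: cvg_monotone_convergence => //.
  - move=> k; rewrite (_ : (fun s => _) =
      EFin \o (lindley_operator (ramp x k) X \o W)).
      apply/measurable_EFinP/measurableT_comp => //.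
      apply: continuous_measurable_fun.
      exact: (continuous_lindley_operator (cr k) (r_ge0 k) (r_le1 k)).
    apply/funext => s.
    exact: (lindley_operatorE (cr k) (r_ge0 k) (r_le1 k)).
  - by move=> k s _; apply: integral_ge0 => t _; rewrite lee_fin ramp_ge0.
  - move=> s _ m n mn; apply: ge0_le_integral => //.
    + by move=> t _; rewrite lee_fin ramp_ge0.
    + apply/measurable_EFinP/measurableT_comp; first exact: measurable_ramp.
      exact: measurable_lindley_step.
    + apply/measurable_EFinP/measurableT_comp; first exact: measurable_ramp.
      exact: measurable_lindley_step.
    + by move=> t _; rewrite lee_fin ramp_homo.
apply: eq_integral => s _; apply/esym/cvg_lim => //.
rewrite ccdfE (_ : [set t | _] = [set t | (x < lindley_map (W s, X t))%R]).
  exact: (cvg_ramp_integral (measurable_lindley_step X (W s))).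
by apply/seteqP; split => t; rewrite /= /lindley_map/= lt_max ltrBrDr ltNge x_ge0.
Qed.

(** The test function vanishes on the nonnegative reals, where the recursion takes
    its values, and is positive elsewhere. *)
Lemma stationary_ge0 : {ae P, forall t, (0 <= W t)%R}.
Proof.
pose f (u : R) := ramp 0 1 (- u).
have cf : continuous f.
  move=> u; apply: (@continuous_comp _ _ _ (fun v : R => - v)%R (ramp 0 1)).
    by apply: cvgN; exact: cvg_id.
  exact: continuous_ramp.
have E := lindley_stationary_integral cf (fun u => ramp_ge0 0 1 (- u))
  (fun u => ramp_le1 0 1 (- u)) lawX indWX W_rec W_lim.
have {E} fW0 : \int[P]_t `|(f (W t))%:E| = 0.
  under eq_integral do rewrite gee0_abs ?lee_fin ?ramp_ge0//.
  rewrite E; apply: integral0_eq => s _; apply: integral0_eq => t _.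
  by rewrite /f ramp_eq0// oppr_le0 le_max lexx.
have mfW : measurable_fun setT (fun t => (f (W t))%:E).
  apply/measurable_EFinP/measurableT_comp => //.
  exact: continuous_measurable_fun.
have [+ _] := ae_eq_integral_abs P measurableT mfW.
move=> /(_ fW0); apply: filterS => t /(_ I) [].
apply: contraPT; rewrite -ltNge /f /ramp mul1r subr0 => W0.
by apply/eqP; rewrite gt_eqF// lt_min ltr01 lt_max oppr_gt0 W0 orbT.
Qed.

End Stationary.
End Tails.

(** * Rapid variation and asymptotics *)

Section Asymptotics.
Context {R : realType} {d : measure_display} {T : measurableType d}.
Variable P : probability T R.
Set Implicit Arguments.
Unset Strict Implicit.
Unset Printing Implicit Defensive.

Lemma ccdf_tail (Y : {RV P >-> R}) x : ccdf Y x = (tail Y x)%:E.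
Proof. by rewrite fineK// fin_num_measure. Qed.

Lemma tail_ge0 (Y : {RV P >-> R}) x : 0 <= tail Y x.
Proof. exact: fine_ge0. Qed.

Lemma le_tail (Y : {RV P >-> R}) x y : x <= y -> tail Y y <= tail Y x.
Proof. by move=> xy; rewrite -lee_fin -!ccdf_tail ccdf_nonincreasing. Qed.

Lemma measurable_ccdf_shift (Y V : {RV P >-> R}) x :
  measurable_fun setT (fun s => ccdf Y (x + V s)).
Proof.
apply: (measurableT_comp (@ccdf_measurable _ _ _ _ Y)).
exact: measurable_funD.
Qed.

Lemma ae_False : ~ {ae P, forall t, False}.
Proof.
move=> [N [mN N0 sub]].
have NT : N = setT by rewrite -subTset => t _; exact: sub.
by move: N0; rewrite NT [P _]probability_setT => /eqP; rewrite onee_eq0.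
Qed.

Section Difference.
Variables A B X : {RV P >-> R}.
Hypotheses (indAB : independent_RV A B) (XE : forall t, X t = B t - A t).

(** A zero tail would make the positive integrand [tail B (x + A s)] vanish almost
    everywhere. *)
Lemma tail_diff_gt0 x : (forall y, 0 < tail B y) -> 0 < tail X x.
Proof.
move=> B_gt0; rewrite lt_neqAle tail_ge0 andbT; apply/negP => /eqP X0.
have : (\int[P]_s `|ccdf B (x + A s)| = 0)%E.
  under eq_integral do rewrite gee0_abs//.
  by rewrite -(ccdf_indep_diff _ indAB XE) ccdf_tail -X0.
move=> /(ae_eq_integral_abs P measurableT (measurable_ccdf_shift B A x)) H.
apply: ae_False; apply: filterS H => s /(_ I) /=.
by rewrite ccdf_tail => -[] /eqP; rewrite gt_eqF.
Qed.

(** The bound on the ratio of the tails of [B] holds beyond some [M]; since [A] is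
    nonnegative, [x > M] puts every [x + A s] beyond [M], and the bound can be
    integrated over [s]. *)
Lemma tail_diff_rapid (y e : R) :
  {ae P, forall t, 0 <= A t} -> exp_rapidly_varyingNy B -> 0 < y -> 0 < e ->
  \forall x \near +oo, tail X (x + y) <= e * tail X x.
Proof.
move=> A_ge0 [B_gt0 /(_ y)[+ _ _]] y_gt0 e_gt0.
move=> /(_ y_gt0) /cvgrPdist_le /(_ e e_gt0) [M [_ HM]].
near=> x.
have xM : M < x by near: x; apply: nbhs_pinfty_gt; exact: num_real.
rewrite -lee_fin EFinM -!ccdf_tail !(ccdf_indep_diff _ indAB XE).
rewrite -ge0_integralZl_EFin//; [|exact: measurable_ccdf_shift|exact: ltW].
apply: ae_ge0_le_integral => //.
- exact: measurable_ccdf_shift.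
- by move=> s _; rewrite mule_ge0// lee_fin ltW.
- by apply: emeasurable_funM => //; exact: measurable_ccdf_shift.
apply: filterS A_ge0 => s As _.
rewrite !ccdf_tail -EFinM lee_fin.
have /HM : M < x + A s by rewrite (lt_le_trans xM)// lerDl.
rewrite sub0r normrN ger0_norm ?divr_ge0 ?tail_ge0// ler_pdivrMr//.
by rewrite addrAC.
Unshelve. all: by end_near. Qed.

End Difference.

Section FixedPoint.
Variables X W : {RV P >-> R}.
Hypotheses (W_ge0 : {ae P, forall t, 0 <= W t})
  (W_fix : forall x, 0 <= x -> ccdf W x = (\int[P]_s ccdf X (x + W s))%E).

Lemma pmf0_cdf : (pmf W 0)%:E = cdf W 0.
Proof.
have m0 : measurable (W @^-1` [set 0]) by exact: measurable_RV_preimage.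
have mle : measurable (W @^-1` `]-oo, 0]) by exact: measurable_RV_preimage.
have [N [mN N0 sub]] := W_ge0.
rewrite /pmf /cdf /distribution /pushforward fineK ?fin_num_measure//.
apply/eqP; rewrite eq_le.
rewrite le_measure ?inE//=; last by move=> t /= ->; rewrite in_itv/=.
rewrite -[leRHS](measureU0 m0 mN N0) le_measure ?inE//; first exact: measurableU.
move=> t; rewrite /= in_itv/= => Wt; case: (leP 0 (W t)) => W0; [left|right].
  by apply/eqP; rewrite eq_le Wt.
by apply: sub => /=; apply/negP; rewrite -ltNge.
Qed.

(** The part of the integral in [W_fix] carried by the event [W = 0]. *)
Lemma tail_fix_ge x : 0 <= x -> tail X x * pmf W 0 <= tail W x.
Proof.
move=> x_ge0; rewrite -lee_fin -ccdf_tail W_fix//.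
have m0 : measurable (W @^-1` [set 0]) by exact: measurable_RV_preimage.
have pmfE : (pmf W 0)%:E = P (W @^-1` [set 0]).
  by rewrite fineK ?fin_num_measure.
rewrite EFinM pmfE -[in leLHS](setIT (W @^-1` _)) -integral_indic//.
rewrite -ge0_integralZl_EFin//; [|exact/measurable_EFinP|exact: tail_ge0].
apply: ge0_le_integral => //.
- by move=> s _; rewrite mule_ge0// lee_fin tail_ge0.
- by apply: emeasurable_funM => //; exact/measurable_EFinP.
- exact: measurable_ccdf_shift.
move=> s _; rewrite indicE; case: (boolP (s \in _)) => [|_]; last by rewrite mule0.
by rewrite inE => /= ->; rewrite mule1 addr0 ccdf_tail.
Qed.

(** Splitting the integral in [W_fix] at [W = e]: the integrand is at most
    [tail X x] before, and at most [tail X (x + e)] after. *)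
Lemma tail_fix_le x e : 0 <= x -> 0 <= e ->
  tail W x <= tail X x * fine (cdf W e) + tail X (x + e).
Proof.
move=> x_ge0 e_ge0; rewrite -lee_fin -ccdf_tail W_fix//.
have me : measurable (W @^-1` `]-oo, e]) by exact: measurable_RV_preimage.
have cdfE : (fine (cdf W e))%:E = P (W @^-1` `]-oo, e]).
  by rewrite fineK ?fin_num_measure.
rewrite EFinD EFinM cdfE.
rewrite -[X in (_ * P X)%E](setIT (W @^-1` _)) -integral_indic//.
have -> : (tail X (x + e))%:E = (\int[P]_s (tail X (x + e))%:E)%E.
  by rewrite integral_cst//= [P _]probability_setT mule1.
rewrite -ge0_integralZl_EFin//; [|exact/measurable_EFinP|exact: tail_ge0].
rewrite -ge0_integralD//; first last.
- by move=> s _; rewrite lee_fin tail_ge0.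
- by apply: emeasurable_funM => //; exact/measurable_EFinP.
- by move=> s _; rewrite mule_ge0// lee_fin tail_ge0.
apply: ae_ge0_le_integral => //.
- exact: measurable_ccdf_shift.
- by move=> s _; rewrite adde_ge0 ?mule_ge0// lee_fin tail_ge0.
- apply: emeasurable_funD => //.
  by apply: emeasurable_funM => //; exact/measurable_EFinP.
apply: filterS W_ge0 => s Ws _; rewrite ccdf_tail indicE -EFinM -EFinD lee_fin.
case: (boolP (s \in _)) => [_|].
  by rewrite mulr1 ler_wpDr ?tail_ge0// le_tail// lerDl.
rewrite notin_setE/= in_itv/= => /negP; rewrite -ltNge => es.
by rewrite mulr0 add0r le_tail// lerD2l ltW.
Qed.

Lemma pmf0_gt0 : tail X 0 < 1 -> 0 < pmf W 0.
Proof.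
move=> X0; suff W0 : tail W 0 <= tail X 0.
  rewrite -lte_fin pmf0_cdf cdf_1_ccdf ccdf_tail -EFinB lte_fin subr_gt0.
  exact: le_lt_trans X0.
rewrite -lee_fin -ccdf_tail W_fix//.
have -> : (tail X 0)%:E = (\int[P]_s (tail X 0)%:E)%E.
  by rewrite integral_cst//= [P _]probability_setT mule1.
apply: ae_ge0_le_integral => //.
- exact: measurable_ccdf_shift.
- by move=> s _; rewrite lee_fin tail_ge0.
apply: filterS W_ge0 => s Ws _.
by rewrite ccdf_tail lee_fin le_tail// add0r.
Qed.

(** The lower bound [tail_fix_ge] is sharp because [tail_fix_le] holds for every
    cutoff: the cutoff is chosen first, by right-continuity of [cdf W] at 0, and
    [x] afterwards, by rapid variation. *)
Lemma tail_fix_equiv :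
  (forall x, 0 < tail X x) -> 0 < pmf W 0 ->
  (forall y e, 0 < y -> 0 < e ->
    \forall x \near +oo, tail X (x + y) <= e * tail X x) ->
  tail W x / (tail X x * pmf W 0) @[x --> +oo] --> (1 : R).
Proof.
move=> X_gt0 p_gt0 X_rapid; apply/cvgrPdist_le => e e_gt0.
set p := pmf W 0 in p_gt0 *.
(* The cutoff and the rapid variation each cost c out of a total of e * p. *)
pose c := e * p / 2.
have c_gt0 : 0 < c by rewrite divr_gt0// mulr_gt0.
have cdfW : fine (cdf W y) @[y --> 0^'+] --> p.
  by apply: fine_cvg; rewrite pmf0_cdf; exact: cdf_right_continuous.
near (0 : R)^'+ => y.
have y_gt0 : 0 < y by [].
have Wy : fine (cdf W y) <= p + c.
  by near: y; apply: (cvgr_le p) => //; rewrite ltrDl.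
near=> x.
have x_ge0 : 0 <= x by near: x; apply: nbhs_pinfty_ge; exact: num_real.
have Xy : tail X (x + y) <= c * tail X x by near: x; exact: X_rapid.
have den_gt0 : 0 < tail X x * p by rewrite mulr_gt0.
rewrite distrC ger0_norm; last first.
  by rewrite subr_ge0 ler_pdivlMr// mul1r tail_fix_ge.
rewrite lerBlDr ler_pdivrMr// (le_trans (tail_fix_le x_ge0 (ltW y_gt0)))//.
have -> : (e + 1) * (tail X x * p) = tail X x * (p + c) + c * tail X x.
  by rewrite /c; field.
by rewrite lerD// ler_wpM2l// ltW.
Unshelve. all: by end_near. Qed.

End FixedPoint.
End Asymptotics.

Theorem proposition3 (R : realType) (d : measure_display)
    (T : measurableType d) (P : probability T R)
    (A B X W : {RV P >-> R}) (A_ B_ X_ W_ : nat -> {RV P >-> R})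
    (A_ge0 : {ae P, forall t, 0 <= A t})
    (B_ge0 : {ae P, forall t, 0 <= B t})
    (AB_indep : independent_RV A B)
    (X_def : forall t, X t = B t - A t)
    (X_neg : (0 < P [set t | (X t < 0)%R])%E)
    (A_law : forall n, same_law (A_ n) A)
    (B_law : forall n, same_law (B_ n) B)
    (A_indep : mutually_independent A_)
    (B_indep : mutually_independent B_)
    (A_B_indep : independent_families A_ B_)
    (X__def : forall n t, X_ n.+1 t = B_ n.+1 t - A_ n t)
    (W0_ge0 : {ae P, forall t, 0 <= W_ 0%N t})
    (W0_indep : independent_families (fun _ : unit => W_ 0%N)
                                     (fun n : nat => X_ n.+1))
    (W_rec : lindley_recursion X_ W_)
    (W_lim : cvg_in_law W_ W)
    (B_rapid : exp_rapidly_varyingNy B) :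
  tail W x / (tail X x * pmf W 0) @[x --> +oo] --> (1 : R).
Proof.
pose h (z : R * R) : R := z.2 - z.1.
have mh : measurable_fun setT h.
  by apply: measurable_funB; [exact: measurable_snd|exact: measurable_fst].
(* B_ is used from index 1 on, so its families are shifted by one. *)
have predK : cancel succn predn by [].
have X_indep : mutually_independent (fun n => X_ n.+1).
  apply: (mutually_independent_pairs (U := A_) (V := B_ \o succn) mh) => //.
  - exact: mutually_independent_comp predK B_indep.
  - exact: independent_families_comp predK A_B_indep.
have X_law n : same_law (X_ n.+1) X.
  apply: (same_law_of_pair (U := A_ n) (V := B_ n.+1) (U' := A) (V' := B) mh) => //.
  exact: independent_families_RV A_B_indep.
have WX_indep n : independent_RV (W_ n) (X_ n.+1).
  exact: (recursion_independent (Y := W_) (Z := fun n => X_ n.+1)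
    measurable_lindley_map).
have W_ge0 : {ae P, forall t, 0 <= W t}.
  exact: (stationary_ge0 X_law WX_indep W_rec W_lim).
have W_fix := ccdf_stationary X_law WX_indep W_rec W_lim.
have X_gt0 x : 0 < tail X x.
  by apply: (tail_diff_gt0 AB_indep X_def); case: B_rapid.
apply: tail_fix_equiv => //; last first.
  by move=> y e y_gt0 e_gt0; exact: (tail_diff_rapid AB_indep X_def).
apply: (pmf0_gt0 W_ge0 W_fix); rewrite -lte_fin -ccdf_tail ccdf_1_cdf.
rewrite lteBlDr ?fin_num_measure// lteDl// (lt_le_trans X_neg)//.
rewrite le_measure ?inE//; last by move=> t /= /ltW Xt; rewrite in_itv.
- rewrite [X in measurable X](_ : _ = X @^-1` `]-oo, 0[).
    by apply: measurable_RV_preimage; exact: measurable_itv.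
  by apply/seteqP; split => t; rewrite /= in_itv.
- by apply: measurable_RV_preimage; exact: measurable_itv.
Qed.
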